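(* Let $k=k(n)$ and $\Delta=\Delta(n)$ be integer-valued nondecreasing functions of $n$ tending to infinity with $k<\Delta$. For each $n$ let $G=G(n)$ be a graph on $n$ vertices with maximum degree at most $\Delta$, and let $L$ be a random $(k,\mathcal{C})$-list assignment for $G$, where $|\mathcal{C}|=\sigma=\sigma(n)$. Suppose that $k=O\left((\log n)^{1/4}\right)$ and $\Delta=O\left(n^{1/(3k^3)}\right)$. For any constant $\epsilon>0$ the following holds: (i) if $k=o(\log\Delta)$ and $\sigma(n)\ge(1+\epsilon)n^{1/k^2}\Delta^{1/k}k$, then with high probability $G$ is $L$-colorable; (ii) if $k=C\log\Delta$ for a constant $C>0$ and $\sigma(n)\ge(1+\epsilon)n^{1/k^2}\exp(1/C)k$, then with high probability $G$ is $L$-colorable; (iii) if $k=\omega(\log\Delta)$ and $\sigma(n)\ge(1+\epsilon)n^{1/k^2}k$, then with high probability $G$ is $L$-colorable.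
   Context: Graphs are finite and simple; $\log$ is the natural logarithm. A list assignment $L$ for a graph $G$ assigns to each vertex $v$ a set $L(v)$ of colors. $G$ is $L$-colorable if there is a proper vertex coloring $\varphi$ of $G$ with $\varphi(v)\in L(v)$ for every $v\in V(G)$. A random $(k,\mathcal{C})$-list assignment for $G$, where $\mathcal{C}=\{1,2,\dots,\sigma\}$ (with $\sigma=\sigma(n)\ge k(n)$), is obtained by choosing, for each vertex $v$, the list $L(v)$ independently and uniformly at random from all $k$-element subsets of $\mathcal{C}$. An event $A_n$ occurs with high probability if $\lim_{n\to\infty}\mathbb{P}[A_n]=1$. Asymptotic notation is with respect to $n\to\infty$. *)

(* Defs.v *)
From HB Require Import structures.
From mathcomp Require Export all_boot all_order all_algebra.
From mathcomp Require Export all_classical all_reals all_analysis.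
Export Order.TTheory GRing.Theory Num.Theory.
Export numFieldNormedType.Exports.

Set Implicit Arguments.
Unset Strict Implicit.
Unset Printing Implicit Defensive.

Local Open Scope ring_scope.

Definition simple_graph (V : finType) (e : rel V) : Prop :=
  symmetric e /\ irreflexive e.

Definition max_degree (V : finType) (e : rel V) : nat :=
  (\max_(v : V) #|[set u | e v u]%SET|)%N.

Definition L_colorable (V K : finType) (e : rel V)
    (L : {ffun V -> {set K}}) : bool :=
  [exists phi : {ffun V -> K},
    [forall u, forall v, e u v ==> (phi u != phi v)]
    && [forall v, phi v \in L v]].

Definition uniform_ksubset (R : realType) (K : finType) (k : nat)
    (S : {set K}) : R :=
  if #|S| == k then ('C(#|K|, k)%:R)^-1 else 0.

(* The lists L v are independent and uniform over the k-subsets of K, so their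
   joint mass function is the product of the marginal ones. It sums to 1 as
   soon as k <= #|K|. *)
Definition random_list_pr (R : realType) (V K : finType) (k : nat)
    (A : pred {ffun V -> {set K}}) : R :=
  \sum_(L : {ffun V -> {set K}} | A L) \prod_(v : V) uniform_ksubset R k (L v).

Local Open Scope classical_set_scope.

(* The Landau notations need a normed codomain, hence nat -> R^o. *)
Definition little_omega (R : realType) (f g : nat -> R^o) : Prop :=
  g =o_\oo f.

(* Main.v *)
Require Import Defs.
From mathcomp Require Import zify ring lra.

Set Implicit Arguments.
Unset Strict Implicit.
Unset Printing Implicit Defensive.

(** The only obstructions that survive a first-moment count are connected sets
of k + 1 vertices that all carry the same list; their expected number is at most
n Delta^k (k / sigma)^(k^2) up to a factor exp (O(k ln k)), and the bound on sigma
makes this small.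

Deterministic part.  Say that a set of vertices sees the colors of its lists.  If
the coloring fails, take a minimal set H of vertices that cannot be colored from
its lists.  Minimality gives three facts: every color of a vertex of H is on the
list of another vertex of H ([critical_shared]); H is connected through edges
whose ends share a color ([critical_connected]); and, since distinct colors
everywhere would be a proper coloring, Hall's theorem provides a subset W of H
that sees fewer than #|W| colors ([critical_hall]).  The lists of H therefore
overlap a lot:
- if #|H| = m, the at least k + 1 vertices of W see at most #|W| - 1 colors and
  each further color is used at least twice, so H sees at most
  k (m - k + 1) / 2 colors ([critical_palette]);
- every connected piece of H with t + 1 vertices sees at most k (t + 1) - t
  colors, each new vertex sharing a color with an older one ([critical_grow]).
With the cut-off M = 2 k^2, the first bound is used when m <= M, and otherwise
the second one for a piece with M + 1 vertices ([obstruction]).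

Probabilistic part.  The lists of r given vertices use at most q colors with
probability at most sigma^q (q / sigma)^(k r) ([pr_palette_le]), and there are
at most n (M Delta)^t connected sets with t + 1 <= M + 1 vertices
([leq_card_grown]).  Summing over the sets and over t gives
[pr_not_colorable_le].

Estimates.  Write u = ln n / k^2 and v = ln Delta / k.  In each of the three
regimes ln sigma >= ln k + h + u + v for large n, with h = ln (1 + eps) / 2.
For m = k + 1 the logarithm of the bound is then at most
k^2 (u + v) - k^2 (h + u + v) + O(k ln k) = - k^2 h + O(k ln k).  The growth
conditions on k and Delta say that u is at least of order k^2 and that
k v <= O(1) + u / (3 k), so that each further vertex, which costs at most
k v + O(k^2 ln k), gains at least k u / 2 and only helps.  A piece with M + 1
vertices costs k^2 u + o(k^2 u) and gains M u = 2 k^2 u.  All the terms together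
are at most exp (- k^2 h + O(k ln k)) ([total_bound]), which tends to 0. *)

Section Combinatorics.
Import boot.finset.
Local Open Scope set_scope.
Local Open Scope nat_scope.

(** * Systems of distinct representatives *)

Definition palette (V K : finType) (L : V -> {set K}) (T : {set V}) : {set K} :=
  \bigcup_(v in T) L v.

Lemma paletteP (V K : finType) (L : V -> {set K}) (T : {set V}) c :
  reflect (exists2 v, v \in T & c \in L v) (c \in palette L T).
Proof. exact: bigcupP. Qed.

Lemma palette_setU (V K : finType) (L : V -> {set K}) (A B : {set V}) :
  palette L (A :|: B) = palette L A :|: palette L B.
Proof.
apply/setP=> c; rewrite in_setU; apply/paletteP/orP.
  by case=> v /setUP[] vA cv; [left|right]; apply/paletteP; exists v.
by case=> /paletteP[v vA cv]; exists v; rewrite // inE vA ?orbT.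
Qed.

Lemma palette1 (V K : finType) (L : V -> {set K}) v :
  palette L [set v] = L v.
Proof. exact: big_set1. Qed.

Lemma paletteD (V K : finType) (L : V -> {set K}) (B : {set K}) (T : {set V}) :
  palette (fun v => L v :\: B) T = palette L T :\: B.
Proof.
apply/setP=> c; rewrite in_setD; apply/paletteP/andP.
  by case=> v vT; rewrite inE => /andP[cB cv]; split => //; apply/paletteP; exists v.
by case=> cB /paletteP[v vT cv]; exists v; rewrite // inE cB.
Qed.

(** Hall's marriage theorem, by the classical induction on the size of S: split S
along a proper nonempty subset for which Hall's condition is tight, if there is one; otherwise
any color may be given to any vertex, since losing one color keeps the
condition. *)
Lemma hall_marriage (V K : finType) (c0 : K) (L : V -> {set K}) (S : {set V}) :
  (forall W : {set V}, W \subset S -> #|W| <= #|palette L W|) ->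
  exists phi : V -> K,
    {in S, forall v, phi v \in L v} /\ {in S &, injective phi}.
Proof.
elim: {S}_.+1 {-2}S L (ltnSn #|S|) => // n IH S L ltSn hallS.
have [->|/set0Pn[x xS]] := eqVneq S set0.
  by exists (fun=> c0); split=> [v|v w]; rewrite inE.
have [/existsP[W /and3P[WS Wn0 tight]]|slack] := boolP
  [exists W : {set V}, [&& W \proper S, W != set0 & #|palette L W| <= #|W|]].
- have WsubS := proper_sub WS.
  have [|X XW|f [fL finj]] := IH W L.
  + exact: leq_trans (proper_card WS) ltSn.
  + exact/hallS/(fintype.subset_trans XW).
  have [||g [gL ginj]] := IH (S :\: W) (fun v => L v :\: palette L W).
  + move: Wn0; rewrite -card_gt0 (cardsD S W) (setIidPr WsubS).
    by have := subset_leq_card WsubS; lia.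
  + move=> X /subsetDP[XS XW].
    have := hallS (X :|: W); rewrite subUset XS WsubS => /(_ isT).
    rewrite palette_setU paletteD cardsU (eqP (_ : X :&: W == set0)) ?setI_eq0 //.
    rewrite cards0 cardsU cardsD.
    by lia.
  exists (fun v => if v \in W then f v else g v); split=> [v vS|v w vS wS].
    case: ifP => vW; first exact: fL.
    by have := gL v; rewrite !inE vS vW => /(_ isT)/andP[].
  case: ifP => vW; case: ifP => wW.
  + exact: finj.
  + have := gL w; rewrite !inE wS wW => /(_ isT)/andP[+ _] fg.
    by rewrite -fg; case/negP; apply/paletteP; exists v => //; exact: fL.
  + have := gL v; rewrite !inE vS vW => /(_ isT)/andP[+ _] fg.
    by rewrite fg; case/negP; apply/paletteP; exists w => //; exact: fL.
  + by apply: ginj; rewrite inE ?vW ?wW.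
- have /card_gt0P[c cx] : 0 < #|L x|.
    by have := hallS [set x]; rewrite palette1 cards1 sub1set => ->.
  have [||g [gL ginj]] := IH (S :\ x) (fun v => L v :\: [set c]).
  + by move: ltSn; rewrite (cardsD1 x S) xS.
  + move=> X XS; rewrite paletteD.
    have [->|Xn0] := eqVneq X set0; first by rewrite cards0.
    have XpS : X \proper S.
      by apply: (sub_proper_trans XS); apply: properD1.
    move: slack; rewrite negb_exists => /forallP/(_ X).
    rewrite XpS Xn0 /= -ltnNge cardsD => ltX.
    have : #|palette L X :&: [set c]| <= #|[set c]| by apply/subset_leq_card/subsetIr.
    by rewrite cards1; lia.
  have gc v : v \in S -> v != x -> g v != c /\ g v \in L v.
    by move=> vS vx; have := gL v; rewrite !inE vS vx => /(_ isT)/andP[].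
  exists (fun v => if v == x then c else g v); split=> [v vS|v w vS wS].
    by case: eqVneq => [->//|vx]; have [] := gc v vS vx.
  case: (eqVneq v x) => [->|vx]; case: (eqVneq w x) => [->//|wx].
  + by move=> cg; have [] := gc w wS wx; rewrite -cg eqxx.
  + by move=> cg; have [] := gc v vS vx; rewrite cg eqxx.
  + by apply: ginj; rewrite !inE ?vx ?wx.
Qed.

(** * Critical sets of vertices *)

Definition colorable_on (V K : finType) (e : rel V) (L : V -> {set K})
    (S : {set V}) : bool :=
  [exists phi : {ffun V -> K},
    [forall u in S, forall v in S, e u v ==> (phi u != phi v)]
    && [forall v in S, phi v \in L v]].

Lemma colorable_onP (V K : finType) (e : rel V) (L : V -> {set K}) (S : {set V}) :
  reflect (exists phi : V -> K,
             {in S &, forall u v, e u v -> phi u != phi v}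
             /\ {in S, forall v, phi v \in L v})
          (colorable_on e L S).
Proof.
apply: (iffP existsP) => [[phi /andP[/forall_inP col /forall_inP phiL]]|].
  exists phi; split=> // u v uS vS; apply/implyP.
  by have /forall_inP := col u uS; apply.
case=> phi [col phiL]; exists (finfun phi); apply/andP; split.
  apply/forall_inP=> u uS; apply/forall_inP=> v vS; apply/implyP=> euv.
  by rewrite !ffunE col.
by apply/forall_inP=> v vS; rewrite ffunE phiL.
Qed.

Lemma colorable_onT (V K : finType) (e : rel V) (L : {ffun V -> {set K}}) :
  colorable_on e L [set: V] -> L_colorable e L.
Proof.
case/colorable_onP=> phi [col phiL]; apply/existsP; exists (finfun phi).
apply/andP; split.
  by apply/forallP=> u; apply/forallP=> v; apply/implyP=> euv; rewrite !ffunE col.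
by apply/forallP=> v; rewrite ffunE phiL.
Qed.

Definition critical (V K : finType) (e : rel V) (L : V -> {set K}) (H : {set V}) :=
  ~~ colorable_on e L H /\
  forall S : {set V}, S \proper H -> colorable_on e L S.

Lemma critical_exists (V K : finType) (e : rel V) (L : {ffun V -> {set K}}) :
  ~~ L_colorable e L -> exists H, critical e L H.
Proof.
move=> ncol.
have /minset_exists[H /minsetP[ncolH minH] _] :
    [pred S | ~~ colorable_on e L S] [set: V].
  by move: ncol; apply: contra; exact: colorable_onT.
exists H; split=> // S SH; apply: contraT => ncolS.
by move: (SH); rewrite (minH S ncolS (proper_sub SH)) fintype.properxx.
Qed.

Section Critical.
Variables (V K : finType) (c0 : K) (e : rel V) (L : V -> {set K}) (H : {set V}).
Hypotheses (esym : symmetric e) (eirr : irreflexive e) (Hcrit : critical e L H).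

(** Otherwise a coloring of H minus v would extend to v with the color c. *)
Lemma critical_shared v c : v \in H -> c \in L v ->
  exists2 u, u \in H :\ v & c \in L u.
Proof.
move=> vH cv; have [ncol mincol] := Hcrit.
have /colorable_onP[phi [col phiL]] := mincol _ (properD1 vH).
apply/exists_inP; apply: contraR ncol.
rewrite negb_exists => /forallP nbr; apply/colorable_onP.
have phic u : u \in H -> u != v -> phi u != c.
  move=> uH uv; have := nbr u; rewrite !inE uH uv /=; apply: contraNneq => <-.
  by apply: phiL; rewrite !inE uv.
exists (fun u => if u == v then c else phi u); split=> [x y xH yH exy|x xH].
  case: (eqVneq x v) => [xv|xv]; case: (eqVneq y v) => [yv|yv].
  + by move: exy; rewrite xv yv eirr.
  + by rewrite eq_sym phic.
  + exact: phic.
  + by apply: col; rewrite // !inE ?xv ?yv.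
by case: eqVneq => [->//|xv]; apply: phiL; rewrite !inE xv.
Qed.

(** By Hall's theorem the alternative is a choice of pairwise distinct colors,
which is a proper coloring of H. *)
Lemma critical_hall : exists2 W : {set V}, W \subset H & #|palette L W| < #|W|.
Proof.
have [ncol _] := Hcrit.
apply/exists_inP; apply: contraR ncol; rewrite negb_exists => /forallP big.
have [W WH|phi [phiL phiI]] := @hall_marriage V K c0 L H.
  by have := big W; rewrite WH /= -leqNgt.
apply/colorable_onP; exists phi; split=> // u v uH vH.
by apply: contraTneq => /phiI -> //; rewrite eirr.
Qed.

(** Otherwise colorings of A and of H minus A, which exist by minimality, could
be put together without a conflict. *)
Lemma critical_connected (A : {set V}) : A \proper H -> A != set0 ->
  exists u v, [/\ u \in A, v \in H :\: A, e u v & exists2 c, c \in L u & c \in L v].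
Proof.
move=> AH An0; have [ncol mincol] := Hcrit.
have /colorable_onP[f [colf fL]] := mincol _ AH.
have BH : H :\: A \proper H.
  rewrite properEcard subsetDl cardsD (setIidPr (proper_sub AH)).
  by move: An0 (proper_card AH); rewrite -card_gt0; lia.
have /colorable_onP[g [colg gL]] := mincol _ BH.
have [/exists_inP[u uA /exists_inP[v vB /andP[euv /exists_inP[c cu cv]]]]|none] :=
  boolP [exists u in A, exists v in H :\: A, e u v && [exists c in L u, c \in L v]].
  by exists u, v; split=> //; exists c.
case/negP: ncol; apply/colorable_onP.
have cross u v : u \in A -> v \in H -> v \notin A -> e u v -> f u != g v.
  move=> uA vH vA euv; apply: contra none => /eqP fg.
  apply/exists_inP; exists u => //; apply/exists_inP; exists v; rewrite ?inE ?vA //.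
  rewrite euv; apply/exists_inP; exists (f u); first exact: fL.
  by rewrite fg; apply: gL; rewrite inE vA.
exists (fun v => if v \in A then f v else g v); split=> [u v uH vH euv|v vH].
  case: ifPn => uA; case: ifPn => vA.
  + exact: colf.
  + exact: cross.
  + by rewrite eq_sym; apply: cross; rewrite // esym.
  + by apply: colg; rewrite // inE ?uA ?vA.
by case: ifPn => vA; [apply: fL|apply: gL; rewrite inE vA].
Qed.

End Critical.

(** * Counting connected sets *)

Definition boundary (V : finType) (e : rel V) (T : {set V}) : {set V} :=
  [set v in ~: T | [exists u in T, e u v]].

(** These are the connected sets with t + 1 vertices, obtained by adding adjacent
vertices one at a time; this description is the one that makes them easy to
count. *)
Fixpoint grown (V : finType) (e : rel V) (t : nat) : {set {set V}} :=
  if t is t'.+1 then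
    \bigcup_(T in grown e t') [set v |: T | v in boundary e T]
  else [set [set v] | v : V].

Lemma card_grown (V : finType) (e : rel V) t (T : {set V}) : T \in grown e t -> #|T| = t.+1.
Proof.
elim: t T => [|t IH] T /=; first by case/imsetP=> v _ ->; rewrite cards1.
case/bigcupP=> T' /IH sT' /imsetP[v]; rewrite !inE => /andP[vT' _] ->.
by rewrite cardsU1 vT' sT'.
Qed.

Lemma leq_card_bigcup (I T : finType) (A : {set I}) (F : I -> {set T}) :
  #|\bigcup_(i in A) F i| <= \sum_(i in A) #|F i|.
Proof.
elim/big_rec2: _ => [|i n B _ leBn]; first by rewrite cards0.
by apply: leq_trans (leq_card_setU _ _) _; rewrite leq_add2l.
Qed.

Lemma card_boundary (V : finType) (e : rel V) (T : {set V}) :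
  #|boundary e T| <= #|T| * max_degree e.
Proof.
have sub : boundary e T \subset \bigcup_(u in T) [set v | e u v].
  apply/fintype.subsetP=> v; rewrite !inE => /andP[_ /exists_inP[u uT euv]].
  by apply/bigcupP; exists u; rewrite ?inE.
apply: leq_trans (subset_leq_card sub) _; apply: leq_trans (leq_card_bigcup _ _) _.
rewrite -sum_nat_const; apply: leq_sum => u _.
by rewrite /max_degree (bigD1 u) //= leq_maxl.
Qed.

(** A set with i vertices has at most i D neighbors by which it can grow. *)
Lemma leq_card_grown (V : finType) (e : rel V) (M D t : nat) :
  max_degree e <= D -> t <= M -> #|grown e t| <= #|V| * (M * D) ^ t.
Proof.
move=> leD; elim: t => [|t IH] leM /=.
  by rewrite muln1; apply: leq_imset_card.
apply: leq_trans (leq_card_bigcup _ _) _.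
rewrite expnSr mulnA.
apply: leq_trans (_ : #|grown e t| * (M * D) <= _); last first.
  by rewrite leq_mul2r IH ?orbT // ltnW.
rewrite -sum_nat_const; apply: leq_sum => T /card_grown sT.
apply: leq_trans (leq_imset_card _ _) _; apply: leq_trans (card_boundary _ _) _.
by rewrite sT leq_mul.
Qed.

(** * Few colors on a connected set *)

Section Obstruction.
Variables (V K : finType) (c0 : K) (e : rel V) (L : V -> {set K}) (k : nat).
Variable (H : {set V}).
Hypotheses (esym : symmetric e) (eirr : irreflexive e) (Hcrit : critical e L H).
Hypothesis Lk : forall v, #|L v| = k.

(** Each vertex added to the growing set shares a color with an older vertex, so
it brings at most k - 1 new colors. *)
Lemma critical_grow t : t < #|H| ->
  exists T, [/\ T \in grown e t, T \subset H & #|palette L T| + t <= k * t.+1].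
Proof.
elim: t => [|t IH] ltH.
  have /card_gt0P[v vH] := ltH.
  exists [set v]; split; first exact: imset_f.
    by rewrite sub1set.
  by rewrite palette1 Lk; lia.
have [T [gT TH palT]] := IH (ltnW ltH).
have sT := card_grown gT.
have TpH : T \proper H by rewrite properEcard TH sT.
have [|u [v [uT]]] := critical_connected esym Hcrit TpH.
  by rewrite -card_gt0 sT.
rewrite inE => /andP[vT vH] euv [c cu cv].
exists (v |: T); split=> /=.
- apply/bigcupP; exists T => //; apply: imset_f; rewrite !inE vT /=.
  by apply/exists_inP; exists u.
- by rewrite subUset sub1set vH.
- rewrite palette_setU palette1 cardsU Lk.
  have : 0 < #|L v :&: palette L T|.
    by apply/card_gt0P; exists c; rewrite inE cv; apply/paletteP; exists u.
  have : #|L v :&: palette L T| <= k by rewrite -(Lk v) subset_leq_card ?subsetIl.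
  by lia.
Qed.

(** Let W be the subset given by Hall's theorem.  It sees at least the k colors of
one list, so it has at least k + 1 vertices.  A color of H that W does not see is
on two vertices of H minus W, so there are at most k (#|H| - #|W|) / 2 of those;
the total is largest when #|W| = k + 1. *)
Lemma critical_palette : 1 < k ->
  k < #|H| /\ 2 * #|palette L H| + k * (k - 1) <= k * #|H|.
Proof.
move=> k1; have [W WH palW] := critical_hall c0 eirr Hcrit.
have leWH := subset_leq_card WH.
have kW : k <= #|palette L W|.
  have /card_gt0P[v vW] : 0 < #|W| by apply: leq_ltn_trans palW.
  rewrite -(Lk v); apply/subset_leq_card/fintype.subsetP => c cv.
  by apply/paletteP; exists v.
split; first by apply: leq_trans leWH; lia.
pose X := palette L H :\: palette L W.
have HX : #|palette L H| <= #|palette L W| + #|X|.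
  by rewrite -(cardsID (palette L W) (palette L H)) leq_add2r subset_leq_card // subsetIr.
suff X2 : 2 * #|X| <= k * (#|H| - #|W|) by nia.
have <- : \sum_(v in H :\: W) #|L v| = k * (#|H| - #|W|).
  rewrite (eq_bigr (fun=> k)) // sum_nat_const mulnC cardsD.
  by rewrite (setIidPr WH).
(* Double counting of the pairs (vertex of H minus W, color of its list). *)
have -> : \sum_(v in H :\: W) #|L v| = \sum_(c : K) #|[set v in H :\: W | c \in L v]|.
  under eq_bigr do rewrite -sum1_card big_mkcond /=.
  rewrite exchange_big /=; apply: eq_bigr => c _.
  rewrite -big_mkcondr -sum1_card; apply: eq_bigl => v.
  by rewrite !inE.
rewrite mulnC -sum_nat_const big_mkcond /=; apply: leq_sum => c _.
case: ifP => // /setDP[/paletteP[v vH cv] cW].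
have [u] := critical_shared eirr Hcrit vH cv.
rewrite !inE => /andP[uv uH] cu.
have nW w : c \in L w -> w \notin W.
  by move=> cw; apply: contra cW => wW; apply/paletteP; exists w.
have <- : #|[set u; v]| = 2 by rewrite cards2 uv.
apply/subset_leq_card/fintype.subsetP => w; rewrite !inE => /orP[]/eqP->.
  by rewrite uH cu nW.
by rewrite vH cv nW.
Qed.

End Obstruction.

Lemma obstruction (V K : finType) (e : rel V) (L : {ffun V -> {set K}}) (k M : nat) :
  symmetric e -> irreflexive e -> (forall v, #|L v| = k) ->
  1 < k -> k <= #|K| -> k <= M -> ~~ L_colorable e L ->
  (exists2 T, T \in grown e M & #|palette L T| + M <= k * M.+1) \/
  (exists t : 'I_M, k <= t /\ exists2 T, T \in grown e t &
      2 * #|palette L T| + k * (k - 1) <= k * t.+1).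
Proof.
move=> esym eirr Lk k1 kK kM /critical_exists[H Hcrit].
have /card_gt0P[c0 _] : 0 < #|K| by lia.
have [ltMH|leHM] := ltnP M #|H|.
  have [T [gT _ palT]] := critical_grow esym Hcrit Lk ltMH.
  by left; exists T.
have [kH palH] := critical_palette c0 eirr Hcrit Lk k1.
have ltM : #|H|.-1 < M by lia.
right; exists (Ordinal ltM) => /=; split; first by lia.
have [|T [gT TH _]] := @critical_grow _ _ _ _ _ _ esym Hcrit Lk #|H|.-1.
  by lia.
have eTH : T = H by apply/eqP; rewrite eqEcard TH (card_grown gT); lia.
by exists T => //; rewrite eTH prednK //; lia.
Qed.

End Combinatorics.

(** * The law of the random lists *)

Section RandomLists.
Import boot.finset.
Local Open Scope set_scope.
Local Open Scope ring_scope.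
Variables (R : realType) (V K : finType) (k : nat).
Hypotheses (k_gt0 : (0 < k)%N) (kK : (k <= #|K|)%N).
Implicit Types (T : {set V}) (B : {set K}) (A : pred {ffun V -> {set K}}).

Notation mass L := (\prod_(v : V) uniform_ksubset R k (L v)).

Lemma uniform_ksubset_ge0 B : 0 <= uniform_ksubset R k B.
Proof. by rewrite /uniform_ksubset; case: ifP => // _; rewrite invr_ge0. Qed.

Lemma mass_ge0 (L : {ffun V -> {set K}}) : 0 <= mass L.
Proof. by apply: prodr_ge0 => v _; exact: uniform_ksubset_ge0. Qed.

Lemma sum_uniform_ksubset B :
  \sum_(S : {set K} | S \subset B) uniform_ksubset R k S
    = 'C(#|B|, k)%:R / 'C(#|K|, k)%:R.
Proof.
rewrite /uniform_ksubset -big_mkcondr /= sumr_const -cards_draws -[LHS]mulr_natl.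
by congr (_%:R / _); apply: eq_card => S; rewrite !inE.
Qed.

(** The lists are independent, so the probability is a product over the vertices,
in which those outside T contribute 1. *)
Lemma pr_palette_sub T B :
  random_list_pr R k [pred L : {ffun V -> {set K}} | palette L T \subset B]
    = ('C(#|B|, k)%:R / 'C(#|K|, k)%:R) ^+ #|T|.
Proof.
pose Q v (S : {set K}) := (v \in T) ==> (S \subset B).
have marginal v : \sum_(S | Q v S) uniform_ksubset R k S =
    if v \in T then 'C(#|B|, k)%:R / 'C(#|K|, k)%:R else 1.
  rewrite /Q; case: (v \in T) => /=; first exact: sum_uniform_ksubset.
  rewrite (eq_bigl (fun S : {set K} => S \subset [set: K])) => [|S]; last by rewrite subsetT.
  by rewrite sum_uniform_ksubset cardsT divff // pnatr_eq0 -lt0n bin_gt0.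
rewrite -prodr_const /random_list_pr.
rewrite [RHS]big_mkcond /= -(eq_bigr _ (fun v _ => marginal v)).
rewrite bigA_distr_big_dep; apply: eq_bigl => L; rewrite inE.
apply/fintype.subsetP/familyP => [sub v|fam c /paletteP[v vT]].
  rewrite unfold_in /Q; apply/implyP=> vT.
  apply/fintype.subsetP => c cv; apply: sub.
  by apply/paletteP; exists v.
by have := fam v; rewrite unfold_in /Q vT => /fintype.subsetP; apply.
Qed.

Lemma random_list_pr_total : random_list_pr R k (fun L : {ffun V -> {set K}} => true) = 1.
Proof.
rewrite -[RHS](expr0 ('C(#|[set: K]|, k)%:R / 'C(#|K|, k)%:R)) -(cards0 V).
rewrite -pr_palette_sub; apply: eq_bigl => L.
by rewrite inE subsetT.
Qed.

Lemma random_list_pr_compl A :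
  random_list_pr R k A = 1 - random_list_pr R k (fun L => ~~ A L).
Proof.
rewrite -random_list_pr_total /random_list_pr [X in X - _](bigID A) /=.
by rewrite addrK.
Qed.

(** The union bound.  The events need to cover A only where all the lists have
size k, because the law gives no mass to the other list assignments. *)
Lemma random_list_pr_le A (I : finType) (P : pred I)
    (E : I -> pred {ffun V -> {set K}}) :
  (forall L : {ffun V -> {set K}}, (forall v, #|L v| = k) -> A L ->
     exists2 i, P i & E i L) ->
  random_list_pr R k A <= \sum_(i | P i) random_list_pr R k (E i).
Proof.
move=> cover; rewrite /random_list_pr.
under [leRHS]eq_bigr do rewrite big_mkcond.
rewrite exchange_big /= big_mkcond; apply: ler_sum => L _.
have rest_ge0 (Q : pred I) : 0 <= \sum_(i | Q i) (if E i L then mass L else 0).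
  by apply: sumr_ge0 => i _; case: ifP => // _; exact: mass_ge0.
case: ifP => AL //.
have [/forallP Lk|] := boolP [forall v, #|L v| == k]; last first.
  rewrite negb_forall => /existsP[v Lv].
  by rewrite [leLHS](bigD1 v) //= {1}/uniform_ksubset (negbTE Lv) mul0r.
have [|i Pi EiL] := cover L _ AL; first by move=> v; apply/eqP.
by rewrite [leRHS](bigD1 i) //= EiL lerDl.
Qed.

Lemma bin_ratio_le (a q s : nat) : (a <= q)%N -> (a <= s)%N -> (k <= s)%N ->
  'C(a, k)%:R / 'C(s, k)%:R <= (q%:R / s%:R) ^+ k :> R.
Proof.
move=> aq lea les.
have s0 : (0 < s)%N by apply: leq_trans les.
apply: le_trans (_ : (a%:R / s%:R) ^+ k <= _); last first.
  by rewrite lerXn2r ?nnegrE ?divr_ge0 // ler_pM2r ?invr_gt0 ?ltr0n // ler_nat.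
rewrite expr_div_n ler_pdivrMr ?ltr0n ?bin_gt0 // mulrAC.
rewrite ler_pdivlMr ?exprn_gt0 ?ltr0n //.
rewrite -!natrX -!natrM ler_nat.
rewrite -(leq_pmul2r (fact_gt0 k)) mulnAC bin_ffact -[leqRHS]mulnA bin_ffact.
elim: (k) => [|i IH]; first by [].
rewrite !ffactnSr !expnS.
have step : ((a - i) * s <= a * (s - i))%N by rewrite mulnBl mulnBr; nia.
have := leq_mul IH step; nia.
Qed.

(** A set of at most q colors is contained in the image of one of the #|K|^q maps
from 'I_q to K; the union bound over those maps avoids binomial coefficients at
the price of a factor at most q^q, which is harmless in the range of use. *)
Lemma pr_palette_le T (q : nat) :
  random_list_pr R k [pred L : {ffun V -> {set K}} | (#|palette L T| <= q)%N]
    <= #|K|%:R ^+ q * (q%:R / #|K|%:R) ^+ (k * #|T|).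
Proof.
have K0 : (0 < #|K|)%N by apply: leq_trans kK.
have /card_gt0P[c0 _] := K0.
apply: le_trans (_ : \sum_(f : {ffun 'I_q -> K})
    random_list_pr R k [pred L : {ffun V -> {set K}} | palette L T \subset f @: 'I_q] <= _).
  apply: random_list_pr_le => L _; rewrite inE => leq.
  exists [ffun i : 'I_q => nth c0 (enum (palette L T)) i] => //.
  rewrite inE; apply/fintype.subsetP=> c; rewrite -mem_enum => cP.
  have ltc : (index c (enum (palette L T)) < q)%N.
    by apply: leq_trans leq; rewrite cardE index_mem.
  by apply/imsetP; exists (Ordinal ltc); rewrite // ffunE /= nth_index.
apply: le_trans (_ : \sum_(f : {ffun 'I_q -> K}) (q%:R / #|K|%:R) ^+ (k * #|T|) <= _).
  apply: ler_sum => f _; rewrite pr_palette_sub exprM.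
  rewrite lerXn2r ?nnegrE ?exprn_ge0 ?divr_ge0 //.
  apply: bin_ratio_le => //; last exact: max_card.
  by rewrite -[leqRHS]card_ord; exact: leq_imset_card.
by rewrite sumr_const card_ffun card_ord -[leLHS]mulr_natl natrX.
Qed.

End RandomLists.

Section FiniteBound.
Local Open Scope ring_scope.

(** The union bound for the event that some connected set of t + 1 vertices sees
at most q colors. *)
Definition sparse_palette_bound (R : realType) (n D s k M t q : nat) : R :=
  (n * (M * D) ^ t)%:R * s%:R ^+ q * (q%:R / s%:R) ^+ (k * t.+1).

Lemma sum_grown_le (R : realType) (V K : finType) (e : rel V) (k D M t q : nat) :
  (0 < k)%N -> (k <= #|K|)%N -> (max_degree e <= D)%N -> (t <= M)%N ->
  \sum_(T in grown e t)
     random_list_pr R k [pred L : {ffun V -> {set K}} | (#|palette L T| <= q)%N]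
  <= sparse_palette_bound R #|V| D #|K| k M t q.
Proof.
move=> k0 kK degD tM; rewrite /sparse_palette_bound -mulrA.
apply: le_trans (_ : \sum_(T in grown e t)
   #|K|%:R ^+ q * (q%:R / #|K|%:R) ^+ (k * t.+1) <= _).
  by apply: ler_sum => T gT; rewrite -(card_grown gT); apply: pr_palette_le.
by rewrite sumr_const -[leLHS]mulr_natl ler_wpM2r // ler_nat leq_card_grown.
Qed.

(** The number of colors allowed is the one of [obstruction]: k (M + 1) - M for a
large piece of a critical set, (k (t + 1) - k (k - 1)) / 2 for a whole critical
set with t + 1 vertices. *)
Lemma pr_not_colorable_le (R : realType) (V K : finType) (e : rel V) (k D M : nat) :
  simple_graph e -> (max_degree e <= D)%N ->
  (1 < k)%N -> (k <= #|K|)%N -> (k <= M)%N ->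
  random_list_pr R k (fun L : {ffun V -> {set K}} => ~~ L_colorable e L) <=
    sparse_palette_bound R #|V| D #|K| k M M (k * M.+1 - M)
    + \sum_(t < M | (k <= t)%N)
        sparse_palette_bound R #|V| D #|K| k M t ((k * t.+1 - k * (k - 1))./2).
Proof.
move=> [esym eirr] degD k1 kK kM; have k0 := ltnW k1.
pose q (t : 'I_M.+1) := (if t == M :> nat then k * M.+1 - M else (k * t.+1 - k * (k - 1))./2)%N.
apply: le_trans (_ : \sum_(t < M.+1 | (k <= t)%N)
    sparse_palette_bound R #|V| D #|K| k M t (q t) <= _); last first.
  rewrite big_mkcond big_ord_recr /= kM /q eqxx addrC lerD2l -big_mkcond /=.
  by apply: ler_sum => t _; rewrite ltn_eqF.
apply: le_trans (_ : \sum_(t < M.+1 | (k <= t)%N) \sum_(T in grown e t)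
  random_list_pr R k [pred L : {ffun V -> {set K}} | (#|palette L T| <= q t)%N] <= _); last first.
  by apply: ler_sum => t _; apply: sum_grown_le => //; rewrite -ltnS.
rewrite pair_big_dep /=.
apply: random_list_pr_le => L Lk.
case/(obstruction esym eirr Lk k1 kK kM) => [[T gT palT]|[t [kt [T gT palT]]]].
  exists (ord_max, T); rewrite /= ?kM ?gT //= /q eqxx.
  by lia.
exists (widen_ord (leqnSn M) t, T); rewrite /= ?kt ?gT //= /q /= ltn_eqF //.
by lia.
Qed.

End FiniteBound.

(** * Estimates *)

Section Exponents.
Local Open Scope ring_scope.
Variable R : realType.

Lemma sparse_palette_boundE (n D s k M t q : nat) :
  (0 < n)%N -> (0 < D)%N -> (0 < s)%N -> (0 < M)%N -> (0 < q)%N ->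
  sparse_palette_bound R n D s k M t q =
  expR (ln n%:R + t%:R * (ln M%:R + ln D%:R)
        + q%:R * ln s%:R + (k * t.+1)%:R * (ln q%:R - ln s%:R)).
Proof.
move=> n0 D0 s0 M0 q0; rewrite /sparse_palette_bound natrM natrX natrM.
have e (x : nat) : (0 < x)%N -> x%:R = expR (ln x%:R) :> R.
  by move=> x0; rewrite lnK // posrE ltr0n.
rewrite !expRD !expRM_natl expRD expRB.
by rewrite -!e // mulrA.
Qed.

(** The variables stand for logarithms, l for ln k, ls for ln s, lM for ln M and
lq for ln q, with k^2 u = ln n and k v = ln D; the set has k + j + 1 vertices.
The terms free of j give the right-hand side: u and v cancel exactly there.  The
coefficient of j is negative because the gain k u / 2 exceeds the rest. *)
Lemma medium_exponent_le (k j ls l h u v a lq q lM : R) :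
  2 <= k -> 0 <= j -> 0 <= l -> 0 <= h -> 0 <= u -> 0 <= v -> 0 <= a ->
  j = 0 \/ 1 <= j ->
  l + h + u + v <= ls ->
  3 * k ^+ 2 * v <= 3 * k * a + u ->
  60 * k * l + 6 * a + 3 * h <= u ->
  lM <= 3 * l ->
  q <= k * (1 + j / 2) ->
  lq <= 4 * l -> (j = 0 -> lq <= l) ->
  k ^+ 2 * u + (k + j) * (lM + k * v) + q * ls + k * (k + j + 1) * (lq - ls)
    <= 4 * k * l - k ^+ 2 * h.
Proof.
move=> k2 j0 l0 h0 u0 v0 a0 jcase lels vle ule lMle qle lq4 lq0.
have k0 : 0 <= k by lra.
have kkj0 : 0 <= k * (k + j + 1) by apply: mulr_ge0; lra.
(* With lq <= 4 l alone, an error of order k^2 l would remain at j = 0, where no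
   gain from further vertices compensates it. *)
have lqle : k * (k + j + 1) * lq <= k * (k + j + 1) * l + 9 * k ^+ 2 * l * j.
  case: jcase => [jz|j1].
    have := lq0 jz; subst j; rewrite !addr0 mulr0 addr0 => lql.
    by rewrite ler_wpM2l //; apply: mulr_ge0; lra.
  have -> : k * (k + j + 1) * l + 9 * k ^+ 2 * l * j
     = k * (k + j + 1) * (4 * l) + 3 * k * l * (3 * k * j - (k + j + 1)) by ring.
  apply: ler_wpDr; last by rewrite ler_wpM2l.
  have kl0 : 0 <= k * l by apply: mulr_ge0.
  have kj : 0 <= (k - 1) * (j - 1) by apply: mulr_ge0; lra.
  by apply: mulr_ge0; lra.
have kj0 : 0 <= k * j by apply: mulr_ge0.
have kk0 : 0 <= k ^+ 2 by apply: exprn_ge0.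
have Els : (k ^+ 2 + k * j / 2) * (h + u + v) <= (k * (k + j + 1) - q) * (ls - l).
  by apply: ler_pM; lra.
have ql : q * l <= k * (1 + j / 2) * l by rewrite ler_wpM2r.
have lMle' : (k + j) * lM <= (k + j) * (3 * l) by rewrite ler_wpM2l //; lra.
(* The coefficient of j. *)
have bracket : 3 * l + k * v + k * l / 2 + 9 * k ^+ 2 * l - k / 2 * (h + u + v) <= 0.
  have uk : 2 * u <= k * u by rewrite ler_wpM2r.
  have kv : k * v <= a + u / 6.
    have : k * (k * v) <= k * (a + u / 6) by lra.
    by rewrite ler_pM2l //; lra.
  have ku : k * (60 * k * l + 6 * a + 3 * h) <= k * u by rewrite ler_wpM2l //; lra.
  have lk : 2 * l <= k * l by rewrite ler_wpM2r.
  have lkk : k * (2 * l) <= k * (k * l) by rewrite ler_wpM2l.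
  have ak : 2 * a <= k * a by rewrite ler_wpM2r.
  have hk : 0 <= k * h by apply: mulr_ge0.
  have vk : 0 <= k * v by apply: mulr_ge0.
  lra.
have jbr : j * (3 * l + k * v + k * l / 2 + 9 * k ^+ 2 * l - k / 2 * (h + u + v)) <= 0.
  by rewrite mulr_ge0_le0.
lra.
Qed.

(** With the same variables as in [medium_exponent_le]: q is so small that the
exponent of s is - M, and M u = 2 k^2 u outweighs the k^2 u that comes from the
choice of the first vertex. *)
Lemma large_exponent_le (k ls l h u v a lq q lM M : R) :
  2 <= k -> 0 <= l -> 0 <= h -> 0 <= u -> 0 <= v -> 0 <= a ->
  l + h + u + v <= ls ->
  3 * k ^+ 2 * v <= 3 * k * a + u ->
  60 * k * l + 6 * a + 3 * h <= u ->
  M = 2 * k ^+ 2 ->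
  lM <= 3 * l ->
  q = k * (M + 1) - M ->
  lq <= 4 * l ->
  k ^+ 2 * u + M * (lM + k * v) + q * ls + k * (M + 1) * (lq - ls)
    <= 4 * k * l - k ^+ 2 * h.
Proof.
move=> k2 l0 h0 u0 v0 a0 lels vle ule -> lMle -> lq4.
have k0 : 0 <= k by lra.
have k2' : 0 <= k ^+ 2 by rewrite exprn_ge0.
have kk : 2 * k <= k ^+ 2 by rewrite expr2 ler_wpM2r.
have qls : 2 * k ^+ 2 * u <= 2 * k ^+ 2 * ls by rewrite ler_wpM2l //; lra.
have MlM : 2 * k ^+ 2 * lM <= 2 * k ^+ 2 * (3 * l) by rewrite ler_wpM2l //; lra.
have qlq : k * (2 * k ^+ 2 + 1) * lq <= k * (2 * k ^+ 2 + 1) * (4 * l).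
  by rewrite ler_wpM2l //; apply: mulr_ge0; lra.
have uk : 2 * u <= k * u by rewrite ler_wpM2r.
have kv : k * v <= a + u / 6.
  have : k * (k * v) <= k * (a + u / 6) by lra.
  by rewrite ler_pM2l //; lra.
have kkv : 2 * k ^+ 2 * (k * v) <= 2 * k ^+ 2 * (a + u / 6).
  by rewrite ler_wpM2l //; lra.
have ku : k ^+ 2 * (60 * k * l + 6 * a + 3 * h) <= k ^+ 2 * u by rewrite ler_wpM2l.
have lk0 : 0 <= k * l by apply: mulr_ge0.
have lk : 2 * (k * l) <= k * (k * l) by rewrite ler_wpM2r.
have lkk : 2 * (k ^+ 2 * l) <= k * (k ^+ 2 * l).
  by rewrite ler_wpM2r // mulr_ge0.
have hk : 0 <= k ^+ 2 * h by apply: mulr_ge0.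
have ak : 0 <= k ^+ 2 * a by apply: mulr_ge0.
lra.
Qed.

End Exponents.

Section Estimates.
Local Open Scope ring_scope.
Variable R : realType.

Lemma ln_nat_le (x k p : nat) : (0 < k)%N -> (0 < x)%N -> (x <= k ^ p)%N ->
  ln x%:R <= p%:R * ln k%:R :> R.
Proof.
move=> k0 x0 xk; rewrite mulr_natl -lnXn ?ltr0n // -natrX.
by rewrite ler_ln ?posrE ?ltr0n ?expn_gt0 ?k0 // ler_nat.
Qed.

Lemma budget_bounds (k t : nat) : (2 <= k)%N -> (k <= t < 2 * k ^ 2)%N ->
  let q := ((k * t.+1 - k * (k - 1))./2)%N in
  [/\ (0 < q)%N, (2 * q <= k * (t - k + 2))%N & (q <= k ^ 4)%N].
Proof.
move=> k2 /andP[kt tM] q.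
have q2 : (2 * q <= k * (t - k + 2))%N.
  have -> : (k * (t - k + 2) = k * t.+1 - k * (k - 1))%N.
    by rewrite -mulnBr; congr (_ * _)%N; move: kt k2; clear; lia.
  by rewrite /q mul2n -[leqRHS]odd_double_half leq_addl.
have k3 : (2 * k ^ 2 <= k ^ 3)%N by rewrite [(k ^ 3)%N]expnS leq_mul2r k2 orbT.
split=> //.
  have : (2 * 1 <= k * t.+1 - k * (k - 1))%N.
    by rewrite -mulnBr leq_mul //; move: kt k2; clear; lia.
  by rewrite /q; move: (_ - _)%N; clear; lia.
rewrite expnS; apply: leq_trans (_ : k * (t - k + 2) <= _)%N.
  by apply: leq_trans q2; rewrite leq_pmull.
rewrite leq_mul2l; apply/orP; right; apply: leq_trans k3.
by move: kt tM k2; clear; move: (2 * k ^ 2)%N => M; lia.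
Qed.

Section Total.
Variables (n D s k : nat) (h a : R).
Hypotheses (k2 : (2 <= k)%N) (n0 : (0 < n)%N) (D0 : (0 < D)%N) (s0 : (0 < s)%N).
Hypotheses (h0 : 0 <= h) (a0 : 0 <= a).
Hypothesis s_large : ln k%:R + h + ln n%:R / k%:R ^+ 2 + ln D%:R / k%:R <= ln s%:R.
Hypothesis D_small : ln D%:R <= a + ln n%:R / (3 * k%:R ^+ 3).
Hypothesis n_large :
  60 * k%:R ^+ 3 * ln k%:R + 6 * k%:R ^+ 2 * a + 3 * k%:R ^+ 2 * h <= ln n%:R.

Let kR0 : 0 < k%:R :> R. Proof. by rewrite ltr0n; lia. Qed.
Let kR2 : 2 <= k%:R :> R. Proof. by rewrite (ler_nat _ 2). Qed.
Let u : R := ln n%:R / k%:R ^+ 2.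
Let v : R := ln D%:R / k%:R.
Let nE : ln n%:R = k%:R ^+ 2 * u :> R.
Proof. by rewrite /u mulrC divfK // lt0r_neq0 // exprn_gt0. Qed.
Let DE : ln D%:R = k%:R * v :> R. Proof. by rewrite /v mulrC divfK // lt0r_neq0. Qed.
Let l0 : 0 <= ln k%:R :> R. Proof. by rewrite ln_ge0 // ler1n; lia. Qed.
Let u0 : 0 <= u. Proof. by rewrite divr_ge0 ?exprn_ge0 ?ler0n // ln_ge0 // ler1n. Qed.
Let v0 : 0 <= v. Proof. by rewrite divr_ge0 ?ler0n // ln_ge0 // ler1n. Qed.
Let vle : 3 * k%:R ^+ 2 * v <= 3 * k%:R * a + u.
Proof.
have : 3 * k%:R * ln D%:R <= 3 * k%:R * (a + ln n%:R / (3 * k%:R ^+ 3)).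
  by rewrite ler_wpM2l // mulr_ge0 // ltW.
rewrite DE mulrDr /u => le1.
have <- : 3 * k%:R * (ln n%:R / (3 * k%:R ^+ 3)) = ln n%:R / k%:R ^+ 2 :> R.
  by field; rewrite lt0r_neq0.
by apply: le_trans le1; rewrite le_eqVlt; apply/orP; left; apply/eqP; ring.
Qed.
Let ule : 60 * k%:R * ln k%:R + 6 * a + 3 * h <= u.
Proof.
rewrite -(ler_pM2l (exprn_gt0 2 kR0)) -nE.
by apply: le_trans n_large; rewrite le_eqVlt; apply/orP; left; apply/eqP; ring.
Qed.

Let k0 : (0 < k)%N. Proof. exact: ltnW. Qed.
Let M := (2 * k ^ 2)%N.
Let M0 : (0 < M)%N. Proof. by rewrite muln_gt0 expn_gt0 k0. Qed.
Let M3 : (M <= k ^ 3)%N. Proof. by rewrite /M [leqRHS]expnS leq_mul2r k2 orbT. Qed.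
Let kleM : (k <= M)%N.
Proof.
by rewrite /M expnS expn1 mulnA -[leqLHS]mul1n leq_mul2r muln_gt0 k0 orbT.
Qed.

Lemma medium_bound (t : nat) : (k <= t < M)%N ->
  sparse_palette_bound R n D s k M t ((k * t.+1 - k * (k - 1))./2)
    <= expR (4 * k%:R * ln k%:R - k%:R ^+ 2 * h).
Proof.
move=> /[dup] kM /andP[kt tM]; set q := (_./2).
have [q0 q2 q4] : [/\ (0 < q)%N, (2 * q <= k * (t - k + 2))%N & (q <= k ^ 4)%N].
  by apply: budget_bounds.
rewrite sparse_palette_boundE // ler_expR nE DE.
have tE : t%:R = k%:R + (t - k)%:R :> R by rewrite -natrD subnKC.
rewrite natrM -(@natr1 _ t) tE.
apply: (@medium_exponent_le R _ _ _ _ _ u v a) => //.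
- by case: (posnP (t - k)) => [->|lt0]; [left|right; rewrite ler1n].
- by apply: ln_nat_le.
- have : (2 * q)%:R <= (k * (t - k + 2))%:R :> R by rewrite ler_nat.
  by rewrite !natrM natrD; lra.
- by apply: ln_nat_le.
- move=> /eqP; rewrite pnatr_eq0 => /eqP tk.
  have -> : ln k%:R = 1%:R * ln k%:R :> R by rewrite mul1r.
  apply: ln_nat_le => //; rewrite expn1 -(@leq_pmul2l 2) //.
  by move: q2; rewrite tk add0n (mulnC k).
Qed.

Lemma large_bound :
  sparse_palette_bound R n D s k M M (k * M.+1 - M)
    <= expR (4 * k%:R * ln k%:R - k%:R ^+ 2 * h).
Proof.
have MkM : (M < k * M.+1)%N by apply: leq_pmull; exact: ltnW.
have q4 : (k * M.+1 - M <= k ^ 4)%N.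
  rewrite mulnS expnS.
  apply: leq_trans (_ : k * M <= _)%N; first by rewrite leq_subLR leq_add2r kleM.
  by rewrite leq_mul2l M3 orbT.
have q0 : (0 < k * M.+1 - M)%N by rewrite subn_gt0.
rewrite sparse_palette_boundE // ler_expR nE DE.
rewrite natrM -(@natr1 _ M).
apply: (@large_exponent_le R _ _ _ _ u v a) => //.
- by rewrite /M natrM natrX.
- by apply: ln_nat_le.
- by rewrite natrB ?(ltnW MkM) // natrM -(@natr1 _ M).
- by apply: ln_nat_le.
Qed.

(** There are at most 2 k^2 + 1 <= k^4 terms, which explains the factor 4 k + 4. *)
Lemma total_bound :
  sparse_palette_bound R n D s k M M (k * M.+1 - M)
  + \sum_(t < M | (k <= t)%N)
      sparse_palette_bound R n D s k M t ((k * t.+1 - k * (k - 1))./2)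
  <= expR ((4 * k%:R + 4) * ln k%:R - k%:R ^+ 2 * h).
Proof.
set Y := expR (4 * k%:R * ln k%:R - k%:R ^+ 2 * h).
apply: le_trans (_ : Y + \sum_(t < M) Y <= _).
  apply: lerD; first exact: large_bound.
  rewrite big_mkcond; apply: ler_sum => t _; case: ifP => [kt|_].
    by apply: medium_bound; rewrite kt /=.
  exact: expR_ge0.
rewrite sumr_const card_ord -mulrS -[leLHS]mulr_natl.
have -> : (4 * k%:R + 4) * ln k%:R - k%:R ^+ 2 * h =
  4%:R * ln k%:R + (4 * k%:R * ln k%:R - k%:R ^+ 2 * h) by ring.
rewrite expRD -/Y ler_wpM2r ?expR_ge0 //.
rewrite expRM_natl lnK ?posrE // -natrX ler_nat.
rewrite (expnD k 2 2) /M.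
have : (4 <= k ^ 2)%N by rewrite -[4%N]/(2 ^ 2)%N leq_exp2r.
by move: (k ^ 2)%N => x; clear; nia.
Qed.

End Total.
End Estimates.

(** * Passage to the limit *)

Local Open Scope classical_set_scope.
Local Open Scope ring_scope.

Lemma near_ln_le (R : realType) (d : R) : 0 < d ->
  \forall k \near \oo, ln k%:R <= d * k%:R.
Proof.
move=> d0; have d20 : 0 < d / 2 by rewrite divr_gt0.
near=> k.
have k0 : 0 < k%:R :> R by rewrite ltr0n; near: k; exact: nbhs_infty_gt.
have : ln (d / 2 * k%:R) < d / 2 * k%:R by rewrite ln_sublinear // mulr_gt0.
rewrite lnM ?posrE // => lt1.
have : - (2 / d) * ln (d / 2) <= k%:R by near: k; exact: nbhs_infty_ger.
rewrite -(ler_pM2l d20) mulNr mulrN mulrA.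
have -> : d / 2 * (2 / d) = 1 by field; rewrite lt0r_neq0.
lra.
Unshelve. all: by end_near. Qed.

(** With x = k, this is why ln n >= c k^4 leaves room for the error terms. *)
Lemma quartic_dominates (R : realType) (x a c h : R) :
  2 <= x -> 0 < c -> ln x <= c / 180 * x ->
  18 * a / c <= x -> 9 * h / c <= x ->
  60 * x ^+ 3 * ln x + 6 * x ^+ 2 * a + 3 * x ^+ 2 * h <= c * x ^+ 4.
Proof.
move=> x2 c0 lnx; rewrite !ler_pdivrMr // => xa xh.
have x0 : 0 <= x by lra.
have x20 : 0 <= x ^+ 2 by apply: exprn_ge0.
have x30 : 0 <= x ^+ 3 by apply: exprn_ge0.
have cx0 : 0 <= c * x by apply: mulr_ge0 => //; exact: ltW.
have t1 : x ^+ 3 * ln x <= x ^+ 3 * (c / 180 * x) by rewrite ler_wpM2l.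
have cx : 2 * (c * x) <= x * (c * x) by rewrite ler_wpM2r.
have t2 : x ^+ 2 * (18 * a) <= x ^+ 2 * (x * (c * x)) by rewrite ler_wpM2l //; lra.
have t3 : x ^+ 2 * (9 * h) <= x ^+ 2 * (x * (c * x)) by rewrite ler_wpM2l //; lra.
lra.
Qed.

Lemma quadratic_dominates (R : realType) (x h y : R) :
  2 <= x -> 0 < h -> ln x <= h / 12 * x -> - y / h <= x ->
  (4 * x + 4) * ln x - x ^+ 2 * h <= y.
Proof.
move=> x2 h0 lnx; rewrite ler_pdivrMr // => xy.
have xl : (4 * x + 4) * ln x <= (4 * x + 4) * (h / 12 * x).
  by rewrite ler_wpM2l //; lra.
have hx0 : 0 <= h * x by apply: mulr_ge0; lra.
have hx : 2 * (h * x) <= x * (h * x) by rewrite ler_wpM2r.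
lra.
Qed.

(** The three regimes differ only in how they imply the last condition, in which h
is the slack that remains above the first-moment threshold: it contributes
- k^2 h to the exponent, which beats the error O(k ln k). *)
Lemma whp_colorable (R : realType) (k Delta sigma : nat -> nat)
    (e : forall n : nat, rel 'I_n) (a c h : R) :
  k @ \oo --> \oo -> (forall n, (k n < Delta n)%N) ->
  (forall n, (k n <= sigma n)%N) -> (forall n, simple_graph (e n)) ->
  (forall n, (max_degree (e n) <= Delta n)%N) ->
  0 <= a -> 0 < c -> 0 < h ->
  (\forall n \near \oo, c * (k n)%:R ^+ 4 <= ln n%:R) ->
  (\forall n \near \oo, ln (Delta n)%:R <= a + ln n%:R / (3 * (k n)%:R ^+ 3)) ->
  (\forall n \near \oo, ln (k n)%:R + h + ln n%:R / (k n)%:R ^+ 2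
      + ln (Delta n)%:R / (k n)%:R <= ln (sigma n)%:R) ->
  (fun n => random_list_pr R (k n) (@L_colorable _ 'I_(sigma n) (e n)))
    @ \oo --> (1 : R).
Proof.
move=> k_oo kDelta ksigma e_simple e_deg a0 c0 h0 k_small Delta_small sigma_large.
apply/cvgrPdist_le => /= eps eps0.
have near_k (P : nat -> Prop) : (\forall m \near \oo, P m) ->
  \forall n \near \oo, P (k n) by exact: k_oo.
have near_k2 := near_k _ (nbhs_infty_ge 2).
have near_lnk (d : R) : 0 < d -> \forall n \near \oo, ln (k n)%:R <= d * (k n)%:R.
  by move=> /near_ln_le; exact: near_k.
have near_kge (x : R) : \forall n \near \oo, x <= (k n)%:R.
  exact: (near_k _ (nbhs_infty_ger x)).
have near_lnk1 := near_lnk _ (divr_gt0 c0 (ltr0n R 180)).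
have near_lnk2 := near_lnk _ (divr_gt0 h0 (ltr0n R 12)).
have near_ka := near_kge (18 * a / c).
have near_kh := near_kge (9 * h / c).
have near_keps := near_kge (- ln eps / h).
near=> n.
have k2 : (2 <= k n)%N by near: n.
have sigma0 : (0 < sigma n)%N by apply: leq_trans (ksigma n); exact: ltnW.
have Delta0 : (0 < Delta n)%N by apply: leq_ltn_trans (kDelta n).
have n0 : (0 < n)%N by near: n; exact: nbhs_infty_gt.
have kK : (k n <= #|'I_(sigma n)|)%N by rewrite card_ord.
have kM : (k n <= 2 * k n ^ 2)%N.
  by rewrite expnS expn1 mulnA -[leqLHS]mul1n leq_mul2r muln_gt0 (ltnW k2) orbT.
have kR : 2 <= (k n)%:R :> R by rewrite (ler_nat _ 2).
rewrite random_list_pr_compl ?(ltnW k2) // opprB addrC subrK.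
rewrite ger0_norm; last by apply: sumr_ge0 => L _; exact: mass_ge0.
apply: le_trans (pr_not_colorable_le _ (e_simple n) (e_deg n) k2 kK kM) _.
rewrite !card_ord.
have n_large : 60 * (k n)%:R ^+ 3 * ln (k n)%:R + 6 * (k n)%:R ^+ 2 * a
    + 3 * (k n)%:R ^+ 2 * h <= ln n%:R.
  apply: le_trans (_ : c * (k n)%:R ^+ 4 <= _); last by near: n.
  by apply: quartic_dominates => //; near: n.
apply: le_trans (total_bound k2 n0 Delta0 sigma0 (ltW h0) a0 _ _ n_large) _.
- by near: n.
- by near: n.
rewrite -[leRHS]lnK ?posrE // ler_expR.
by apply: quadratic_dominates => //; near: n.
Unshelve. all: by end_near. Qed.

Theorem theorem5p1 (R : realType) (k Delta sigma : nat -> nat)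
    (e : forall n : nat, rel 'I_n) (eps : R) :
  {homo k : m n / (m <= n)%N} ->
  {homo Delta : m n / (m <= n)%N} ->
  k @ \oo --> \oo ->
  Delta @ \oo --> \oo ->
  (forall n, (k n < Delta n)%N) ->
  (forall n, (k n <= sigma n)%N) ->
  (forall n, simple_graph (e n)) ->
  (forall n, (max_degree (e n) <= Delta n)%N) ->
  ((fun n => (k n)%:R) : nat -> R^o)
    =O_\oo ((fun n => (ln n%:R) `^ (1 / 4)) : nat -> R^o) ->
  ((fun n => (Delta n)%:R) : nat -> R^o)
    =O_\oo ((fun n => n%:R `^ (1 / (3 * (k n)%:R ^+ 3))) : nat -> R^o) ->
  0 < eps ->
  [/\ ((fun n => (k n)%:R) : nat -> R^o)
        =o_\oo ((fun n => ln (Delta n)%:R) : nat -> R^o) ->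
      (forall n, (1 + eps) * n%:R `^ (1 / (k n)%:R ^+ 2)
                   * (Delta n)%:R `^ (1 / (k n)%:R) * (k n)%:R
                 <= (sigma n)%:R) ->
      (fun n => random_list_pr R (k n) (@L_colorable _ 'I_(sigma n) (e n)))
        @ \oo --> (1 : R),
      forall C : R, 0 < C ->
      (forall n, (k n)%:R = C * ln (Delta n)%:R) ->
      (forall n, (1 + eps) * n%:R `^ (1 / (k n)%:R ^+ 2)
                   * expR (1 / C) * (k n)%:R
                 <= (sigma n)%:R) ->
      (fun n => random_list_pr R (k n) (@L_colorable _ 'I_(sigma n) (e n)))
        @ \oo --> (1 : R)
    & little_omega (fun n => (k n)%:R) (fun n => ln (Delta n)%:R : R^o) ->
      (forall n, (1 + eps) * n%:R `^ (1 / (k n)%:R ^+ 2) * (k n)%:R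
                 <= (sigma n)%:R) ->
      (fun n => random_list_pr R (k n) (@L_colorable _ 'I_(sigma n) (e n)))
        @ \oo --> (1 : R)].
Proof.
move=> _ _ k_oo _ kD ks es ed /eqO_exP[Ck Ck0 kO] /eqO_exP[CD CD0 DO] eps0.
have k_gt0 : \forall n \near \oo, (0 < k n)%N.
  by apply: (k_oo [set m | (0 < m)%N]); exact: nbhs_infty_gt.
have Delta0 n : 0 < (Delta n)%:R :> R by rewrite ltr0n; apply: leq_ltn_trans (kD n).
pose h := ln (1 + eps) / 2.
have h0 : 0 < h by rewrite divr_gt0 // ln_gt0 //; lra.
have hE : ln (1 + eps) = 2 * h by rewrite /h; lra.
have k_small : \forall n \near \oo, (Ck ^+ 4)^-1 * (k n)%:R ^+ 4 <= ln n%:R.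
  near=> n.
  have n1 : (1 <= n)%N by near: n; exact: nbhs_infty_ge.
  have ln0 : 0 <= ln n%:R :> R by rewrite ln_ge0 // ler1n.
  have : `|(k n)%:R : R^o| <= Ck * `|(ln n%:R) `^ (1 / 4) : R^o| by near: n.
  rewrite (ger0_norm (ler0n _ _)) (ger0_norm (powR_ge0 _ _)) => kle.
  rewrite ler_pdivrMl ?exprn_gt0 //.
  have <- : ((ln n%:R) `^ (1 / 4)) ^+ 4 = ln n%:R :> R.
    rewrite -powR_mulrn ?powR_ge0 // -powRrM.
    by rewrite (_ : 1 / 4 * 4%:R = 1 :> R) ?powRr1 //; lra.
  by rewrite -exprMn lerXn2r ?nnegrE ?mulr_ge0 ?powR_ge0 // ltW.
have D_small : \forall n \near \oo,
    ln (Delta n)%:R <= ln (1 + CD) + ln n%:R / (3 * (k n)%:R ^+ 3).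
  near=> n.
  have n0 : 0 < n%:R :> R by rewrite ltr0n; near: n; exact: nbhs_infty_gt.
  have : `|(Delta n)%:R : R^o| <= CD * `|n%:R `^ (1 / (3 * (k n)%:R ^+ 3)) : R^o|.
    by near: n.
  rewrite (ger0_norm (ler0n _ _)) (ger0_norm (powR_ge0 _ _)) => Dle.
  have pn0 : 0 < n%:R `^ (1 / (3 * (k n)%:R ^+ 3)) :> R by exact: powR_gt0.
  rewrite [X in _ + X]mulrC -[X in _ <= _ + X * _]div1r -ln_powR -lnM ?posrE //; last lra.
  rewrite ler_ln ?posrE //; last by rewrite mulr_gt0 //; lra.
  by apply: le_trans Dle _; rewrite ler_wpM2r ?powR_ge0 //; lra.
have lnCD : 0 <= ln (1 + CD) by rewrite ln_ge0 //; lra.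
have Ckinv : 0 < (Ck ^+ 4)^-1 by rewrite invr_gt0 exprn_gt0.
(* Y is the third factor of the lower bound on sigma; it replaces Delta^(1/k) up
   to a factor exp h. *)
have concl (Y : nat -> R) : (\forall n \near \oo, 0 < Y n) ->
    (forall n, (1 + eps) * n%:R `^ (1 / (k n)%:R ^+ 2) * Y n * (k n)%:R
       <= (sigma n)%:R) ->
    (\forall n \near \oo, ln (Delta n)%:R / (k n)%:R <= h + ln (Y n)) ->
    (fun n => random_list_pr R (k n) (@L_colorable _ 'I_(sigma n) (e n)))
      @ \oo --> (1 : R).
  move=> Ynear sY DY.
  apply: (@whp_colorable R k Delta sigma e (ln (1 + CD)) ((Ck ^+ 4)^-1) h) => //.
  near=> n.
  have n0 : 0 < n%:R :> R by rewrite ltr0n; near: n; exact: nbhs_infty_gt.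
  have k0 : 0 < (k n)%:R :> R by rewrite ltr0n; near: n.
  have s0 : 0 < (sigma n)%:R :> R by rewrite ltr0n; apply: leq_trans (ks n); near: n.
  have Y0 : 0 < Y n by near: n.
  have Dk : ln (Delta n)%:R / (k n)%:R <= h + ln (Y n) by near: n.
  have pn0 : 0 < n%:R `^ (1 / (k n)%:R ^+ 2) :> R by exact: powR_gt0.
  have e1 : 0 < 1 + eps by lra.
  have := sY n; rewrite -ler_ln ?posrE ?mulr_gt0 //.
  rewrite !lnM ?posrE ?mulr_gt0 // ln_powR div1r [X in _ + X + _ + _ <= _]mulrC hE.
  lra.
split.
- move=> _ sY; apply: (concl _ _ sY); near=> n; first exact: powR_gt0.
  by rewrite ln_powR div1r mulrC lerDr ltW.
- move=> C C0 kE sY; apply: (concl (fun=> expR (1 / C)) _ sY); near=> n.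
    exact: expR_gt0.
  have k0 : 0 < (k n)%:R :> R by rewrite ltr0n; near: n.
  rewrite expRK (_ : _ / _ = 1 / C); first by rewrite lerDr ltW.
  move: k0; rewrite kE => Cl0; have := gt_eqF Cl0; rewrite mulf_eq0 => /norP[C1 l1].
  by field; rewrite C1 l1.
- move=> /eqoP/(_ h h0) omega sY.
  apply: (concl (fun=> 1)) => [|n|]; [by near=> n|by rewrite mulr1|].
  near=> n; have k0 : 0 < (k n)%:R :> R by rewrite ltr0n; near: n.
  have : `|ln (Delta n)%:R : R^o| <= h * `|(k n)%:R : R^o| by near: n.
  rewrite (ger0_norm (ler0n _ _)) => /(le_trans (ler_norm _)).
  by rewrite ln1 addr0 ler_pdivrMr.
Unshelve. all: by end_near. Qed.
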